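(* There exist finite two-player normal-form games $G$ such that enabling mixed-strategy simulation introduces Pareto-improving Nash equilibria in $G$, but enabling pure-strategy simulation does not introduce Pareto-improving Nash equilibria in $G$.
   Context: A two-player normal-form game (NFG) $G=(S_1,S_2,u)$ has nonempty pure strategy sets and $u=(u_1,u_2):S_1\times S_2\to\mathbb R^2$. $\Sigma_i=\Delta(S_i)$, $u$ is extended by expectation, $\mathrm{NE}(G)$ is the set of Nash equilibria. For $\sigma_2\in\Sigma_2$, $\mathrm{br}(\sigma_2)\subseteq S_1$ is the set of pure best responses of player 1 and $\text{f-br}(\sigma_2)=\arg\max_{t_1\in \mathrm{br}(\sigma_2)}u_2(t_1,\sigma_2)$. For a simulation cost $c>0$, the mixed-strategy simulation game $G^c_{\text{m-sim}}$ and the pure-strategy simulation game $G^c_{\text{p-sim}}$ are the (infinite) NFGs in which player 1's pure strategies are $S_1\cup\{\text{m-sim}\}$, respectively $S_1\cup\{\text{p-sim}\}$, player 2's pure strategies are $\Sigma_2$, $u(s_1,\sigma_2)$ is as in $G$ for $s_1\in S_1$, and $$u_1(\text{m-sim},\sigma_2)=u_1(\mathrm{br}(\sigma_2),\sigma_2)-c,\qquad u_2(\text{m-sim},\sigma_2)=u_2(\text{f-br}(\sigma_2),\sigma_2),$$ $$u_1(\text{p-sim},\sigma_2)=\mathbb E_{s_2\sim\sigma_2}u_1(\mathrm{br}(s_2),s_2)-c,\qquad u_2(\text{p-sim},\sigma_2)=\mathbb E_{s_2\sim\sigma_2}u_2(\text{f-br}(s_2),s_2).$$ Mixed strategies of player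 2 in these games are (Borel) probability distributions over $\Sigma_2$; Nash equilibria are defined as usual. ''Enabling mixed-strategy (resp. pure-strategy) simulation introduces Pareto-improving Nash equilibria in $G$'' means: there is $c_0>0$ such that for every $0<c<c_0$ the game $G^c_{\text{m-sim}}$ (resp. $G^c_{\text{p-sim}}$) has a Nash equilibrium $\mu^*$ with $u_i(\mu^* )>u_i(\sigma)$ for both $i\in\{1,2\}$ and every $\sigma\in\mathrm{NE}(G)$. *)

(* Defs.v *)
From HB Require Import structures.
From mathcomp Require Import all_boot all_order all_algebra.
From mathcomp Require Import all_classical all_reals all_analysis.

Set Implicit Arguments.
Unset Strict Implicit.
Unset Printing Implicit Defensive.

Import Order.TTheory GRing.Theory Num.Theory.
Import numFieldNormedType.Exports.

Local Open Scope classical_set_scope.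
Local Open Scope ring_scope.

(* The points [s1_0] and [s2_0] only witness nonemptiness. *)
Record nfg (R : realType) := NFG {
  S1 : finType;
  S2 : finType;
  s1_0 : S1;
  s2_0 : S2;
  u1 : S1 -> S2 -> R;
  u2 : S1 -> S2 -> R }.

Definition simplex (R : realType) (S : finType) : set {ptws S -> R} :=
  [set p | (forall s, 0 <= p s) /\ \sum_s p s = 1].
Arguments simplex : clear implicits.

(* As a [set_type], [Delta R S] carries the subspace topology of the product
   (pointwise) topology on R^S. *)
Definition Delta (R : realType) (S : finType) : Type := simplex R S.

HB.instance Definition _ (R : realType) (S : finType) :=
  Topological.copy (Delta R S) (set_type (simplex R S)).

Definition weight (R : realType) (S : finType) (p : Delta R S) : S -> R :=
  set_val p.
Coercion weight : Delta >-> Funclass.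

Lemma point_mass_simplex (R : realType) (S : finType) (s : S) :
  (fun t => (t == s)%:R : R) \in simplex R S.
Proof.
apply/mem_set; split=> [t|]; first exact: ler0n.
by rewrite (bigD1 s) //= eqxx big1 ?addr0 // => t /negPf ->.
Qed.

Definition point_mass (R : realType) (S : finType) (s : S) : Delta R S :=
  exist (fun p => p \in simplex R S) _ (point_mass_simplex R s).

Definition Sigma1 (R : realType) (G : nfg R) : Type := Delta R (S1 G).
Definition Sigma2 (R : realType) (G : nfg R) : Type := Delta R (S2 G).
Identity Coercion Delta_of_Sigma1 : Sigma1 >-> Delta.
Identity Coercion Delta_of_Sigma2 : Sigma2 >-> Delta.

HB.instance Definition _ (R : realType) (G : nfg R) :=
  Topological.copy (Sigma2 G) (Delta R (S2 G)).
HB.instance Definition _ (R : realType) (G : nfg R) :=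
  isPointed.Build (Sigma2 G) (point_mass R (s2_0 G)).

Definition Sigma2_borel (R : realType) (G : nfg R) :=
  g_sigma_algebraType (@open (Sigma2 G)).

(* The probability distributions over Sigma_2, i.e. player 2's mixed strategies
   in the simulation games. *)
Definition borel_prob (R : realType) (G : nfg R) : Type :=
  probability (Sigma2_borel G) R.

Definition is_NE (R : realType) (X1 X2 : Type) (v1 v2 : X1 -> X2 -> R)
    (x1 : X1) (x2 : X2) : Prop :=
  (forall y1, v1 y1 x2 <= v1 x1 x2) /\ (forall y2, v2 x1 y2 <= v2 x1 x2).

Section Payoffs.
Variables (R : realType) (G : nfg R).
Implicit Type u : S1 G -> S2 G -> R.

Definition eu_pure1 u (s1 : S1 G) (sigma2 : Sigma2 G) : R :=
  \sum_s2 sigma2 s2 * u s1 s2.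

Definition eu u (sigma1 : Sigma1 G) (sigma2 : Sigma2 G) : R :=
  \sum_s1 sigma1 s1 * eu_pure1 u s1 sigma2.

Definition NE (sigma1 : Sigma1 G) (sigma2 : Sigma2 G) : Prop :=
  is_NE (eu (@u1 R G)) (eu (@u2 R G)) sigma1 sigma2.

Definition br (sigma2 : Sigma2 G) : {set S1 G} :=
  [set t | [forall s, eu_pure1 (@u1 R G) s sigma2 <=
                      eu_pure1 (@u1 R G) t sigma2]]%SET.

Definition f_br (sigma2 : Sigma2 G) : {set S1 G} :=
  [set t in br sigma2 | [forall s in br sigma2,
     eu_pure1 (@u2 R G) s sigma2 <= eu_pure1 (@u2 R G) t sigma2]]%SET.

(* The payoff "u(A, sigma2)" of a set A of pure strategies on which
   u(-, sigma2) is constant: its value at any element of A.  See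
   [eu_setE_br] and [eu_setE_f_br]. *)
Definition eu_set u (A : {set S1 G}) (sigma2 : Sigma2 G) : R :=
  eu_pure1 u (odflt (s1_0 G) [pick t in A]) sigma2.

Lemma br_neq0 (sigma2 : Sigma2 G) : exists t, t \in br sigma2.
Proof.
case: (@arg_maxP _ _ _ (s1_0 G) predT
        (fun s => eu_pure1 (@u1 R G) s sigma2) isT) => t _ tmax.
by exists t; rewrite inE; apply/forallP => s; apply: tmax.
Qed.

Lemma f_br_neq0 (sigma2 : Sigma2 G) : exists t, t \in f_br sigma2.
Proof.
have [t0 t0br] := br_neq0 sigma2.
case: (@arg_maxP _ _ _ t0 (mem (br sigma2))
        (fun s => eu_pure1 (@u2 R G) s sigma2) t0br) => t tbr tmax.
exists t; rewrite inE; apply/andP; split; first exact: tbr.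
by apply/forall_inP => s; apply: tmax.
Qed.

Lemma eu_setE_br (sigma2 : Sigma2 G) t : t \in br sigma2 ->
  eu_set (@u1 R G) (br sigma2) sigma2 = eu_pure1 (@u1 R G) t sigma2.
Proof.
rewrite /eu_set => tbr; case: pickP => [s sbr|/(_ t)]; last by rewrite tbr.
by apply/le_anti; move: sbr tbr; rewrite !inE => /forallP-> /forallP->.
Qed.

Lemma eu_setE_f_br (sigma2 : Sigma2 G) t : t \in f_br sigma2 ->
  eu_set (@u2 R G) (f_br sigma2) sigma2 = eu_pure1 (@u2 R G) t sigma2.
Proof.
rewrite /eu_set => tbr; case: pickP => [s sbr|/(_ t)]; last by rewrite tbr.
case/finset.setIdP: sbr => sb /forall_inP smax.
case/finset.setIdP: tbr => tb /forall_inP tmax.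
by apply/le_anti/andP; split; [apply: tmax | apply: smax].
Qed.

(* In the simulation games [None] is player 1's additional simulation
   strategy. *)
Definition with_sim u (usim : Sigma2 G -> R)
    (a : option (S1 G)) (sigma2 : Sigma2 G) : R :=
  if a is Some s1 then eu_pure1 u s1 sigma2 else usim sigma2.

Definition m_sim_u1 (c : R) : option (S1 G) -> Sigma2 G -> R :=
  with_sim (@u1 R G) (fun sigma2 =>
    eu_set (@u1 R G) (br sigma2) sigma2 - c).

Definition m_sim_u2 : option (S1 G) -> Sigma2 G -> R :=
  with_sim (@u2 R G) (fun sigma2 =>
    eu_set (@u2 R G) (f_br sigma2) sigma2).

Definition p_sim_u1 (c : R) : option (S1 G) -> Sigma2 G -> R :=
  with_sim (@u1 R G) (fun sigma2 =>
    (\sum_s2 sigma2 s2 *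
      eu_set (@u1 R G) (br (point_mass R s2)) (point_mass R s2)) - c).

Definition p_sim_u2 : option (S1 G) -> Sigma2 G -> R :=
  with_sim (@u2 R G) (fun sigma2 =>
    \sum_s2 sigma2 s2 *
      eu_set (@u2 R G) (f_br (point_mass R s2)) (point_mass R s2)).

Definition sim_eu (v : option (S1 G) -> Sigma2 G -> R)
    (x : Delta R (option (S1 G))) (mu : borel_prob G) : R :=
  \sum_a x a * \int[mu]_sigma2 v a sigma2.

Definition introduces_pareto_improving_NE
    (v1 : R -> option (S1 G) -> Sigma2 G -> R)
    (v2 : option (S1 G) -> Sigma2 G -> R) : Prop :=
  exists c0 : R, 0 < c0 /\ forall c : R, 0 < c -> c < c0 ->
    exists (x : Delta R (option (S1 G))) (mu : borel_prob G),
      is_NE (sim_eu (v1 c)) (sim_eu v2) x mu /\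
      forall (sigma1 : Sigma1 G) (sigma2 : Sigma2 G), NE sigma1 sigma2 ->
        eu (@u1 R G) sigma1 sigma2 < sim_eu (v1 c) x mu /\
        eu (@u2 R G) sigma1 sigma2 < sim_eu v2 x mu.

Definition m_sim_introduces_pareto_improving_NE : Prop :=
  introduces_pareto_improving_NE m_sim_u1 m_sim_u2.

Definition p_sim_introduces_pareto_improving_NE : Prop :=
  introduces_pareto_improving_NE p_sim_u1 p_sim_u2.

End Payoffs.

(* Main.v *)
(* Player 2 may opt out ([None], paying 5 to player 2 and 0 to player 1) or play
   one of two symmetric columns.  For each such column [j], player 1 has a safe
   row [(false, j)], paying 2 on [j] and 0 on the other column, and a risky row
   [(true, j)], paying 3 and -3.  Player 2 earns 8 in column [j] against the
   safe row [j] and 0 otherwise.  The two rows tie when [j] has conditional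
   probability 3/4, so player 2's best commitments are the mixtures (3/4, 1/4)
   and (1/4, 3/4), each worth 6; randomizing evenly between these two mixtures
   while player 1 simulates is an equilibrium of the mixed-strategy simulation
   game, with payoffs (3/2 - c, 6).
   Without simulation, earning more than 5 requires the safe row [j] to have
   probability above 5/8; then player 2 plays only [j], against which the risky
   row [j] is strictly better.  So player 2 always opts out.  Pure-strategy
   simulation answers a column [j] by the risky row, which only discourages
   player 2 further, and the same argument applies. *)
Require Import Defs.
From HB Require Import structures.
From mathcomp Require Import all_boot all_order all_algebra.
From mathcomp Require Import all_classical all_reals all_analysis.
From mathcomp Require Import measurable_realfun ring lra.

Set Implicit Arguments.
Unset Strict Implicit.
Unset Printing Implicit Defensive.

Import Order.TTheory GRing.Theory Num.Theory.
Import numFieldNormedType.Exports.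

Local Open Scope classical_set_scope.
Local Open Scope ring_scope.

Lemma big_option (V : nmodType) (T : finType) (F : option T -> V) :
  \sum_a F a = F None + \sum_t F (Some t).
Proof.
rewrite (bigD1 None) //=; congr (_ + _).
rewrite (reindex_omap Some id) => [|[]//].
by apply: eq_bigl => t; rewrite eqxx.
Qed.

(** * Integrals of bounded functions against probability measures *)

Section Probability.
Context d (T : measurableType d) (R : realType).
Implicit Types (P : probability T R) (f : T -> R) (K L : R).

Lemma bounded_integrable P f K : measurable_fun setT f ->
  (forall t, `|f t| <= K) -> P.-integrable setT (EFin \o f).
Proof.
move=> mf fK; apply: measurable_bounded_integrable => //.
  by rewrite -ge0_fin_numE // fin_num_measure.
by exists K; split; rewrite ?num_real // => M /ltW KM t _ /=; apply: le_trans KM.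
Qed.

Lemma Rintegral_prob_cst P r : \int[P]_(_ in setT) r = r.
Proof.
by rewrite Rintegral_cst // [X in fine X](probability_setT P : _ = 1%E) mulr1.
Qed.

Lemma Rintegral_prob_le P f K L : measurable_fun setT f ->
  (forall t, `|f t| <= K) -> (forall t, f t <= L) -> \int[P]_t f t <= L.
Proof.
move=> mf fK fL; rewrite -[leRHS](Rintegral_prob_cst P).
apply: le_Rintegral => //; first exact: bounded_integrable fK.
by apply: (@bounded_integrable _ _ `|L|).
Qed.

Lemma Rintegral_fsum P (I : finType) (F : I -> T -> R) :
  (forall i, P.-integrable setT (EFin \o F i)) ->
  \int[P]_t (\sum_i F i t) = \sum_i \int[P]_t F i t.
Proof.
move=> iF; rewrite /Rintegral; under eq_integral do rewrite -sumEFin.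
rewrite (integral_sum measurableT iF) -sum_fine // => i _.
exact: integrable_fin_num.
Qed.

Lemma Rintegral_dirac (t : T) f : measurable_fun setT f ->
  \int[\d_t]_x f x = f t.
Proof.
move=> mf; rewrite /Rintegral integral_dirac //=; last exact/measurable_EFinP.
by rewrite indicT mul1r.
Qed.

Definition point_of_bool (t0 t1 : T) (b : bool) : T := if b then t1 else t0.

Lemma measurable_point_of_bool t0 t1 :
  measurable_fun setT (point_of_bool t0 t1).
Proof. by []. Qed.

HB.instance Definition _ t0 t1 :=
  isMeasurableFun.Build _ _ _ _ _ (measurable_point_of_bool t0 t1).

(** Encoded as the image of a fair coin, so that integrals reduce to the Bernoulli formula. *)
Definition fair_mixture (t0 t1 : T) : probability T R :=
  distribution (bernoulli_prob (2^-1 : R)) (point_of_bool t0 t1).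

Lemma Rintegral_fair_mixture t0 t1 f K : measurable_fun setT f ->
  (forall t, `|f t| <= K) ->
  \int[fair_mixture t0 t1]_t f t = (f t0 + f t1) / 2.
Proof.
move=> mf fK; set P := fair_mixture _ _.
have K_ge0 : 0 <= K by apply: le_trans (fK t0).
have fK0 t : 0 <= f t + K by have := fK t; rewrite ler_norml; lra.
have mfK : measurable_fun setT (fun t => f t + K) by exact: measurable_funD.
(* Shifting by [K] makes the integrand nonnegative, as the change of variables below requires. *)
suff: \int[P]_t (f t + K) = (f t0 + f t1) / 2 + K.
  rewrite RintegralD ?Rintegral_prob_cst //; first exact: addIr.
    exact: bounded_integrable fK.
  by apply: (@bounded_integrable _ _ `|K|).
rewrite /Rintegral ge0_integral_distribution //; last exact/measurable_EFinP.
rewrite integral_bernoulli_prob /=; last by move=> b; rewrite lee_fin.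
  by rewrite /unstable.onem; lra.
by apply/andP; split; lra.
Qed.

(** Where [s] is selectable, [f] agrees with [g s], so a preimage under [f] is a finite union of
    measurable pieces. The pieces may overlap: how ties in [B] are broken does not matter. *)
Lemma measurable_selection (S : finType) (B : T -> {set S}) (g : S -> T -> R)
    f :
  (forall s, measurable [set t | s \in B t]) ->
  (forall s, measurable_fun setT (g s)) -> (forall t, exists s, s \in B t) ->
  (forall t s, s \in B t -> f t = g s t) -> measurable_fun setT f.
Proof.
move=> mB mg B0 fg _ Y mY.
suff -> : setT `&` f @^-1` Y =
    \bigcup_(s in setT) ([set t | s \in B t] `&` (setT `&` g s @^-1` Y)).
  apply: fin_bigcup_measurable => [|s _]; first exact: finite_finset.
  by apply: measurableI => //; apply: mg.
apply/seteqP; split=> [t [_ Yft]|t [s _ [sB [_ Ygt]]]].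
  have [s sB] := B0 t; exists s => //; split=> //; split=> //=.
  by rewrite -(fg _ _ sB).
by split=> //=; rewrite (fg _ _ sB).
Qed.

End Probability.

(** * The simplex: weights, continuity of coordinates, weighted sums *)

Section Delta.
Variables (R : realType) (S : finType).
Implicit Type p : Delta R S.

Lemma weight_ge0 p s : 0 <= p s.
Proof. by have [+ _] := set_valP p; apply. Qed.

Lemma weight_sum p : \sum_s p s = 1.
Proof. by have [] := set_valP p. Qed.

Lemma weight_le1 p s : p s <= 1.
Proof.
by rewrite -(weight_sum p) (bigD1 s) //= lerDl sumr_ge0 // => *; exact: weight_ge0.
Qed.

Lemma point_massE (s t : S) : point_mass R s t = (t == s)%:R.
Proof. by rewrite /weight set_valE. Qed.

Lemma sum_point_mass (s : S) (f : S -> R) :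
  \sum_t point_mass R s t * f t = f s.
Proof.
rewrite (bigD1 s) //= point_massE eqxx mul1r big1 ?addr0 // => t /negPf ts.
by rewrite point_massE ts mul0r.
Qed.

Lemma continuous_weight s : continuous (fun p => p s).
Proof.
move=> p; apply: (@continuous_comp _ _ _ (set_val : Delta R S -> {ptws S -> R})
  (fun h => h s)).
  exact: initial_continuous.
exact: (@proj_continuous _ (fun=> R) s).
Qed.

Lemma le_weighted_sum p (f : S -> R) K :
  (forall s, f s <= K) -> \sum_s p s * f s <= K.
Proof.
move=> fK; rewrite -[K]mul1r -(weight_sum p) mulr_suml.
by apply: ler_sum => s _; rewrite ler_wpM2l ?weight_ge0.
Qed.

Lemma norm_weighted_sum p (f : S -> R) :
  `|\sum_s p s * f s| <= \sum_s `|f s|.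
Proof.
apply: le_trans (ler_norm_sum _ _ _) _; apply: ler_sum => s _.
by rewrite normrM ger0_norm ?weight_ge0 // ler_piMl ?weight_le1.
Qed.

End Delta.

(** * Measurability and boundedness of the simulation payoffs *)

Section Payoffs.
Variables (R : realType) (G : nfg R).
Implicit Types (mu : borel_prob G) (sigma : Sigma2 G).

Lemma measurable_weight s :
  measurable_fun [set: Sigma2_borel G] (fun sigma : Sigma2_borel G => weight sigma s).
Proof.
apply: (measurability _ (RGenOpens.measurableE R)) => _ [_ [a [b ->] <-]].
rewrite setTI; apply: sub_sigma_algebra.
apply: (proj1 (@continuousP _ _ _) (@continuous_weight R (S2 G) s)).
exact: interval_open.
Qed.

Lemma measurable_eu_pure1 (u : S1 G -> S2 G -> R) s1 :
  measurable_fun [set: Sigma2_borel G] (eu_pure1 u s1 : Sigma2_borel G -> R).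
Proof.
apply: measurable_sum => s2.
by apply: measurable_funM => //; exact: measurable_weight.
Qed.

Lemma eu_pure1_bound (u : S1 G -> S2 G -> R) s1 sigma :
  `|eu_pure1 u s1 sigma| <= \sum_s \sum_s2 `|u s s2|.
Proof.
apply: le_trans (norm_weighted_sum _ _) _.
by rewrite (bigD1 s1) //= lerDl !sumr_ge0 // => s _; rewrite sumr_ge0.
Qed.

Lemma eu_set_bound (u : S1 G -> S2 G -> R) A sigma :
  `|eu_set u A sigma| <= \sum_s \sum_s2 `|u s s2|.
Proof. exact: eu_pure1_bound. Qed.

Lemma measurable_br t :
  measurable [set sigma : Sigma2_borel G | t \in br sigma].
Proof.
suff -> : [set sigma : Sigma2_borel G | t \in br sigma] =
    \bigcap_(s in setT) (setT `&` [set sigma : Sigma2_borel G |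
      eu_pure1 (@u1 R G) s sigma <= eu_pure1 (@u1 R G) t sigma]).
  apply: fin_bigcap_measurable => [|s _]; first exact: finite_finset.
  by apply: measurable_fun_le => //; exact: measurable_eu_pure1.
apply/seteqP; split=> [sigma /=|sigma le_t /=]; rewrite inE.
  by move=> /forallP le_t s _; split=> //; exact: le_t.
by apply/forallP => s; have [] := le_t s.
Qed.

Lemma measurable_f_br t :
  measurable [set sigma : Sigma2_borel G | t \in f_br sigma].
Proof.
suff -> : [set sigma : Sigma2_borel G | t \in f_br sigma] =
    (* The maximum over the varying set [br sigma] becomes an intersection over all rows of
       implications, each written as a union with a complement. *)
    [set sigma : Sigma2_borel G | t \in br sigma] `&`
    \bigcap_(s in setT) (~` [set sigma : Sigma2_borel G | s \in br sigma] `|`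
      (setT `&` [set sigma : Sigma2_borel G |
        eu_pure1 (@u2 R G) s sigma <= eu_pure1 (@u2 R G) t sigma])).
  apply: measurableI; first exact: measurable_br.
  apply: fin_bigcap_measurable => [|s _]; first exact: finite_finset.
  apply: measurableU; first by apply: measurableC; exact: measurable_br.
  by apply: measurable_fun_le => //; exact: measurable_eu_pure1.
apply/seteqP; split=> [sigma /finset.setIdP[tbr /forall_inP le_t]|].
  split=> // s _; have [sbr|sbr] := boolP (s \in br sigma).
    by right; split=> //; exact: le_t.
  by left; exact/negP.
move=> sigma [tbr le_t]; apply/finset.setIdP; split=> //.
by apply/forall_inP => s sbr; have [//|[]//] := le_t s I.
Qed.

Lemma measurable_m_sim_u1 c a :
  measurable_fun [set: Sigma2_borel G] (m_sim_u1 c a : Sigma2_borel G -> R).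
Proof.
case: a => [s|]; first exact: measurable_eu_pure1.
apply: measurable_funB => //.
apply: (measurable_selection measurable_br (@measurable_eu_pure1 (@u1 R G))).
  exact: br_neq0.
by move=> sigma s; exact: eu_setE_br.
Qed.

Lemma measurable_m_sim_u2 a :
  measurable_fun [set: Sigma2_borel G] (m_sim_u2 a : Sigma2_borel G -> R).
Proof.
case: a => [s|]; first exact: measurable_eu_pure1.
apply: (measurable_selection measurable_f_br (@measurable_eu_pure1 (@u2 R G))).
  exact: f_br_neq0.
by move=> sigma s; exact: eu_setE_f_br.
Qed.

Lemma m_sim_u1_bound c a sigma :
  `|m_sim_u1 c a sigma| <= (\sum_s \sum_s2 `|@u1 R G s s2|) + `|c|.
Proof.
case: a => [s|] /=; first by apply: le_trans (eu_pure1_bound _ _ _) _; rewrite lerDl.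
by apply: le_trans (ler_normB _ _) _; rewrite lerD2r eu_set_bound.
Qed.

Lemma m_sim_u2_bound a sigma :
  `|m_sim_u2 a sigma| <= \sum_s \sum_s2 `|@u2 R G s s2|.
Proof. by case: a => [s|] /=; [exact: eu_pure1_bound | exact: eu_set_bound]. Qed.

Lemma sim_eu_point_mass v a mu :
  sim_eu v (point_mass R a) mu = \int[mu]_sigma v a sigma.
Proof. exact: sum_point_mass. Qed.

(** * Barycentres, and pure-strategy simulation as a finite game *)

Section Mean.
Variable mu : borel_prob G.

Let integrable_weight s :
  mu.-integrable setT (EFin \o (fun sigma : Sigma2_borel G => weight sigma s)).
Proof.
apply: (@bounded_integrable _ _ _ _ _ 1); first exact: measurable_weight.
by move=> sigma; rewrite ger0_norm ?weight_ge0 ?weight_le1.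
Qed.

Lemma Rintegral_weighted_sum (w : S2 G -> R) :
  \int[mu]_sigma (\sum_s weight sigma s * w s) =
  \sum_s \int[mu]_sigma weight sigma s * w s.
Proof.
under eq_bigr do rewrite -RintegralZr //.
apply: Rintegral_fsum => s.
apply: (@bounded_integrable _ _ _ _ _ `|w s|).
  by apply: measurable_funM => //; exact: measurable_weight.
by move=> sigma; rewrite normrM ger0_norm ?weight_ge0 // ler_piMl ?weight_le1.
Qed.

Lemma mean_simplex : (fun s => \int[mu]_sigma weight sigma s) \in simplex R (S2 G).
Proof.
apply/mem_set; split=> [s|]; first by apply: Rintegral_ge0 => *; exact: weight_ge0.
rewrite -[LHS]mulr1 mulr_suml.
rewrite -(Rintegral_weighted_sum (fun=> 1)) -[RHS](Rintegral_prob_cst mu).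
by apply: eq_Rintegral => sigma _; rewrite -mulr_suml weight_sum mulr1.
Qed.

(** The barycentre of [mu]. Pure-strategy simulation payoffs are affine in player 2's mixture, so
    they depend on [mu] only through this point. *)
Definition mean : Sigma2 G :=
  exist (fun p => p \in simplex R (S2 G)) _ mean_simplex.

Lemma meanE s : mean s = \int[mu]_sigma weight sigma s.
Proof. by rewrite /weight set_valE. Qed.

Lemma Rintegral_mean (w : S2 G -> R) :
  \int[mu]_sigma (\sum_s weight sigma s * w s) = \sum_s mean s * w s.
Proof. by rewrite Rintegral_weighted_sum; apply: eq_bigr => s _; rewrite meanE. Qed.

End Mean.

Definition certainly sigma : borel_prob G := \d_(sigma : Sigma2_borel G).

Lemma mean_certainly sigma s : mean (certainly sigma) s = sigma s.
Proof. by rewrite meanE Rintegral_dirac //; exact: measurable_weight. Qed.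

(** Payoff matrix of the finite game that has p-sim as an extra row. The cost is charged in every
    column, which is consistent because weights sum to 1. *)
Definition p_sim_pay1 c (a : option (S1 G)) (s : S2 G) : R :=
  if a is Some s1 then @u1 R G s1 s
  else eu_set (@u1 R G) (br (point_mass R s)) (point_mass R s) - c.

Definition p_sim_pay2 (a : option (S1 G)) (s : S2 G) : R :=
  if a is Some s1 then @u2 R G s1 s
  else eu_set (@u2 R G) (f_br (point_mass R s)) (point_mass R s).

Lemma sim_eu_p_sim_u1 c x mu :
  sim_eu (p_sim_u1 c) x mu = \sum_a x a * \sum_s mean mu s * p_sim_pay1 c a s.
Proof.
apply: eq_bigr => a _; congr (_ * _); rewrite -Rintegral_mean.
apply: eq_Rintegral => sigma _; case: a => [//|] /=.
under [RHS]eq_bigr do rewrite mulrBr.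
by rewrite sumrB -mulr_suml weight_sum mul1r.
Qed.

Lemma sim_eu_p_sim_u2 x mu :
  sim_eu (@p_sim_u2 R G) x mu = \sum_a x a * \sum_s mean mu s * p_sim_pay2 a s.
Proof.
apply: eq_bigr => a _; congr (_ * _); rewrite -Rintegral_mean.
by apply: eq_Rintegral => sigma _; case: a.
Qed.

End Payoffs.

(** * The game with an opt-out column, and its equilibria without simulation *)

Section Game.
Variable R : realType.

Definition game_u1 (s : bool * bool) (t : option bool) : R :=
  if t is Some j then
    if s.1 then (if s.2 == j then 3 else - 3) else (if s.2 == j then 2 else 0)
  else 0.

Definition game_u2 (s : bool * bool) (t : option bool) : R :=
  if t is Some j then (if s == (false, j) then 8 else 0) else 5.

Definition game : nfg R := NFG (true, true) None game_u1 game_u2.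

Lemma big_bool2 (F : bool * bool -> R) :
  \sum_s F s =
  F (true, true) + F (true, false) + (F (false, true) + F (false, false)).
Proof.
transitivity (\sum_i \sum_j F (i, j)); last by rewrite !big_bool.
by rewrite pair_bigA; apply: eq_bigr => -[].
Qed.

Lemma big_option_bool (F : option bool -> R) :
  \sum_t F t = F None + (F (Some true) + F (Some false)).
Proof. by rewrite big_option big_bool. Qed.

(* The case [qs = 0] is [game] itself, the general one its pure-strategy
   simulation game: [x], [y], [o] are the weights of the columns
   [Some true], [Some false], [None]; [qa], [qb], [qT], [qD], [qs] those of the
   rows [(false, true)], [(false, false)], [(true, true)], [(true, false)] and
   p-sim. *)
Lemma equilibrium_payoffs (x y o qa qb qT qD qs c : R) :
  0 <= x -> 0 <= y -> 0 <= o -> x + y + o = 1 ->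
  0 <= qa -> 0 <= qb -> 0 <= qT -> 0 <= qD -> 0 <= qs ->
  qa + qb + qT + qD + qs = 1 -> 0 <= c ->
  let U1 := x * (2 * qa + 3 * qT - 3 * qD + 3 * qs) +
            y * (2 * qb + 3 * qD - 3 * qT + 3 * qs) - c * qs in
  let U2 := 8 * (x * qa + y * qb) + 5 * o in
  3 * x - 3 * y <= U1 -> 3 * y - 3 * x <= U1 ->
  8 * qa <= U2 -> 8 * qb <= U2 -> 5 <= U2 ->
  U1 <= 0 /\ U2 <= 5.
Proof.
move=> x0 y0 o0 xyo qa0 qb0 qT0 qD0 qs0 q1 c0 U1 U2 hT hD ha hb ho.
have cqs : 0 <= c * qs by rewrite mulr_ge0.
(* Complementary slackness: [U2] is the average of the column payoffs [8 * qa], [8 * qb] and [5],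
   and none of them exceeds it, so each weighted gap vanishes. *)
have U2E : (U2 - 8 * qa) * x + (U2 - 8 * qb) * y + (U2 - 5) * o = 0.
  by have oE : o = 1 - x - y by [lra]; rewrite /U2 oE; ring.
have ga : 0 <= (U2 - 8 * qa) * x by apply: mulr_ge0; lra.
have gb : 0 <= (U2 - 8 * qb) * y by apply: mulr_ge0; lra.
have go : 0 <= (U2 - 5) * o by apply: mulr_ge0; lra.
have {ga gb go U2E} [ea eb eo] : [/\ (U2 - 8 * qa) * x = 0,
  (U2 - 8 * qb) * y = 0 & (U2 - 5) * o = 0] by split; lra.
(* If [x] were positive, then [8 * qa = U2 >= 5], so [qa >= 5/8] and [qb <= 3/8]; column
   [Some false] is then suboptimal and [y = 0]. Since [qa > 0], player 1 earns less than [3 * x],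
   the payoff of the risky row. *)
have x_eq0 : x = 0.
  have [//|x_neq0] := eqVneq x 0.
  have qaE : U2 = 8 * qa.
    by move/eqP: ea; rewrite mulf_eq0 (negPf x_neq0) orbF => /eqP; lra.
  have y_eq0 : y = 0.
    by move/eqP: eb; rewrite mulf_eq0 => /orP[/eqP|/eqP//]; lra.
  have : x * (2 * qa + 3 * qT - 3 * qD + 3 * qs - 3) < 0.
    by rewrite pmulr_rlt0 ?lt0r ?x_neq0 //; lra.
  by move: hT; rewrite /U1 y_eq0; lra.
have y_eq0 : y = 0.
  have [//|y_neq0] := eqVneq y 0.
  have qbE : U2 = 8 * qb.
    by move/eqP: eb; rewrite mulf_eq0 (negPf y_neq0) orbF => /eqP; lra.
  have : y * (2 * qb + 3 * qD - 3 * qT + 3 * qs - 3) < 0.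
    by rewrite pmulr_rlt0 ?lt0r ?y_neq0 //; lra.
  by move: hD; rewrite /U1 x_eq0; lra.
rewrite /U1 /U2 x_eq0 y_eq0; split; lra.
Qed.

Lemma game_eu_pure1 u s (sigma : Sigma2 game) :
  eu_pure1 u s sigma = sigma None * u s None +
    (sigma (Some true) * u s (Some true) + sigma (Some false) * u s (Some false)).
Proof. exact: big_option_bool. Qed.

Lemma game_weight2 (sigma : Sigma2 game) :
  [/\ 0 <= sigma None, 0 <= sigma (Some true), 0 <= sigma (Some false) &
      sigma None + (sigma (Some true) + sigma (Some false)) = 1].
Proof.
by split; [exact: weight_ge0..|]; have := weight_sum sigma; rewrite big_option_bool.
Qed.

Lemma game_NE_payoffs sigma1 sigma2 : @NE R game sigma1 sigma2 ->
  eu (@u1 R game) sigma1 sigma2 <= 0 /\ eu (@u2 R game) sigma1 sigma2 <= 5.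
Proof.
move=> [br1 br2].
have eu_l u s : eu u (point_mass R s : Sigma1 game) sigma2 = eu_pure1 u s sigma2.
  exact: sum_point_mass.
have eu_r u t : eu u sigma1 (point_mass R t : Sigma2 game) =
    \sum_s sigma1 s * u s t.
  by apply: eq_bigr => s _; rewrite /eu_pure1 sum_point_mass.
have := (br1 (point_mass R (true, true)), br1 (point_mass R (true, false)),
  (br2 (point_mass R None), br2 (point_mass R (Some true)),
   br2 (point_mass R (Some false)))).
rewrite !eu_l !eu_r /eu !big_bool2 !game_eu_pure1 /= /game_u1 /game_u2 /= => h.
have [z0 x0 y0 xyz] := game_weight2 sigma2.
have q0 := @weight_ge0 R (S1 game) sigma1.
have := weight_sum sigma1; rewrite big_bool2 => q1.
(* [lra] treats products as atoms, so the identity that collapses the opt-out terms is supplied by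
   hand. *)
have := congr1 (fun q => sigma2 None * q) q1; rewrite /= mulr1 => oq1.
have [] := @equilibrium_payoffs (sigma2 (Some true)) (sigma2 (Some false))
  (sigma2 None) (sigma1 (false, true)) (sigma1 (false, false))
  (sigma1 (true, true)) (sigma1 (true, false)) 0 0;
  rewrite ?q0 //; case: h => -[h1 h2] [[h3 h4] h5]; lra.
Qed.

(** * Pure-strategy simulation in this game *)

Lemma game_p_sim_pay1 c t :
  p_sim_pay1 (G := game) c None t = (if t is Some _ then 3 else 0) - c.
Proof.
rewrite /=; congr (_ - c).
(* All rows tie against [None], so the second choice is arbitrary. *)
pose best : bool * bool := if t is Some j then (true, j) else (true, true).
rewrite (@eu_setE_br _ game _ best).
  by rewrite /eu_pure1 sum_point_mass; case: t @best => [[]|].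
rewrite inE; apply/forallP => s; rewrite /eu_pure1 !sum_point_mass.
by move: s t @best => [[] []] [[]|] /=; rewrite /game_u1 /=; lra.
Qed.

(** Against a pure column [j] the risky row [(true, j)] is the only best response, so favourable
    tie-breaking cannot help player 2. *)
Lemma game_p_sim_pay2 t :
  p_sim_pay2 (G := game) None t = if t is Some _ then 0 else 5.
Proof.
rewrite /=; have [s s_fbr] := f_br_neq0 (point_mass R t : Sigma2 game).
rewrite (eu_setE_f_br s_fbr) /eu_pure1 sum_point_mass.
move: s_fbr => /finset.setIdP[+ _]; rewrite inE => /forallP s_br.
case: t s_br => [j|//] s_br; have := s_br (true, j).
rewrite /eu_pure1 !sum_point_mass /= /game_u1 /game_u2 /=.
by case: s {s_br} => [[] k] /=; case: j k => [] [] //=; lra.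
Qed.

(** Passing to the barycentre of [mu] turns the equilibrium conditions into those of
    [equilibrium_payoffs], with [qs] the weight of p-sim. Player 2's deviations are Dirac masses at
    the pure columns. *)
Lemma game_p_sim_NE_u2 (c : R) x mu : 0 <= c ->
  is_NE (sim_eu (p_sim_u1 (G := game) c)) (sim_eu (@p_sim_u2 R game)) x mu ->
  sim_eu (@p_sim_u2 R game) x mu <= 5.
Proof.
move=> c0 [br1 br2].
have u2_r t : sim_eu (@p_sim_u2 R game) x (certainly (point_mass R t)) =
    \sum_a x a * p_sim_pay2 (G := game) a t.
  rewrite sim_eu_p_sim_u2; apply: eq_bigr => a _; congr (_ * _).
  by under eq_bigr do rewrite mean_certainly; rewrite sum_point_mass.
have u1_l s : sim_eu (p_sim_u1 c) (point_mass R (Some s)) mu =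
    \sum_t mean mu t * game_u1 s t.
  by rewrite sim_eu_p_sim_u1 sum_point_mass.
have := (br1 (point_mass R (Some (true, true))),
  br1 (point_mass R (Some (true, false))),
  (br2 (certainly (G := game) (point_mass R None)),
   br2 (certainly (G := game) (point_mass R (Some true))),
   br2 (certainly (G := game) (point_mass R (Some false))))).
rewrite !u1_l !u2_r sim_eu_p_sim_u1 sim_eu_p_sim_u2.
rewrite !big_option !big_bool2 !big_option !big_bool.
rewrite !game_p_sim_pay1 !game_p_sim_pay2 /= /game_u1 /game_u2 /= => h.
have [z0 x0 y0 xyz] := game_weight2 (mean mu).
have q0 := @weight_ge0 R (option (S1 game)) x.
have := weight_sum x; rewrite big_option big_bool2 => q1.
have := congr1 (fun q => mean mu None * q) q1; rewrite /= mulr1 => oq1.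
have := congr1 (fun q => c * x None * q) xyz; rewrite /= mulr1 => cxyz.
have [] := @equilibrium_payoffs (mean mu (Some true)) (mean mu (Some false))
  (mean mu None) (x (Some (false, true))) (x (Some (false, false)))
  (x (Some (true, true))) (x (Some (true, false))) (x None) c;
   rewrite ?q0 //; case: h => -[h1 h2] [[h3 h4] h5]; lra.
Qed.

(** * Mixed-strategy simulation: the commitments [(3/4, 1/4)] and [(1/4, 3/4)] *)

Definition skew_weight (i : bool) (t : option bool) : R :=
  if t is Some j then (if i == j then 3 / 4 else 1 / 4) else 0.

Lemma skew_simplex i : skew_weight i \in simplex R (option bool).
Proof.
apply/mem_set; split=> [[j|]|] /=; first by case: (i == j); lra.
  by [].
by rewrite big_option_bool; case: i => /=; lra.
Qed.

Definition skew i : Sigma2 game :=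
  exist (fun p => p \in simplex R (option bool)) _ (skew_simplex i).

Lemma skewE i t : skew i t = skew_weight i t.
Proof. by rewrite /weight set_valE. Qed.

Lemma skew_br i : (false, i) \in br (skew i).
Proof.
rewrite inE; apply/forallP => s; rewrite !game_eu_pure1 !skewE /=.
by move: s i => [[] []] []; rewrite /game_u1 /=; lra.
Qed.

Lemma game_m_sim_u1_skew c i : m_sim_u1 (G := game) c None (skew i) = 3 / 2 - c.
Proof.
rewrite /= (eu_setE_br (skew_br i)) game_eu_pure1 !skewE /=.
by case: i; rewrite /game_u1 /=; lra.
Qed.

Lemma game_m_sim_u2_skew i : 6 <= m_sim_u2 (G := game) None (skew i).
Proof.
have [s s_fbr] := f_br_neq0 (skew i).
rewrite /= (eu_setE_f_br s_fbr).
move/finset.setIdP: s_fbr => [_ /forall_inP/(_ _ (skew_br i))].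
apply: le_trans; rewrite game_eu_pure1 !skewE.
by case: i; rewrite /game_u2 /=; lra.
Qed.

Lemma game_m_sim_u2_le sigma : m_sim_u2 (G := game) None sigma <= 6.
Proof.
have [s s_fbr] := f_br_neq0 sigma.
rewrite /= (eu_setE_f_br s_fbr).
move/finset.setIdP: s_fbr => [+ _]; rewrite inE => /forallP s_br.
have [z0 x0 y0 xyz] := game_weight2 sigma.
(* Let [x], [y], [o] be the weights of column [s.2], the other column and [None]. If [s] is safe,
   comparison with the risky row gives [2x >= 3x - 3y], so [x <= 3y] and
   [8x + 5o <= 6(x + y) + 5o <= 6]. If [s] is risky, player 2 gets only [5o]. *)
have := s_br (true, s.2); rewrite !game_eu_pure1 /=.
by move: s {s_br} => [[] []]; rewrite /game_u1 /game_u2 /=; lra.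
Qed.

Lemma game_m_sim_NE (c : R) : 0 < c -> c < 1 / 2 ->
  exists (x : Delta R (option (S1 game))) (mu : borel_prob game),
    [/\ is_NE (sim_eu (m_sim_u1 (G := game) c)) (sim_eu (@m_sim_u2 R game)) x mu,
        sim_eu (m_sim_u1 (G := game) c) x mu = 3 / 2 - c &
        6 <= sim_eu (@m_sim_u2 R game) x mu].
Proof.
move=> c0 c_lt.
pose mu : borel_prob game :=
  fair_mixture R (skew true : Sigma2_borel game) (skew false).
exists (point_mass R None), mu.
have int1 a : \int[mu]_sigma m_sim_u1 (G := game) c a sigma =
    (m_sim_u1 (G := game) c a (skew true) +
     m_sim_u1 (G := game) c a (skew false)) / 2.
  by apply: Rintegral_fair_mixture; [exact: measurable_m_sim_u1|exact: m_sim_u1_bound].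
have u1E : sim_eu (m_sim_u1 (G := game) c) (point_mass R None) mu = 3 / 2 - c.
  by rewrite sim_eu_point_mass int1 !game_m_sim_u1_skew; lra.
have u2_ge : 6 <= sim_eu (@m_sim_u2 R game) (point_mass R None) mu.
  rewrite sim_eu_point_mass (@Rintegral_fair_mixture _ _ _ _ _ _ _
    (measurable_m_sim_u2 _) (m_sim_u2_bound _)).
  have := game_m_sim_u2_skew true; have := game_m_sim_u2_skew false; lra.
split=> //; split=> [x'|mu'].
  rewrite u1E; apply: le_weighted_sum => -[s|]; rewrite int1; last first.
    by rewrite !game_m_sim_u1_skew; lra.
  (* On average the two columns are equally likely, so a safe row yields 1 and a risky row 0. The
     bound [c < 1 / 2] keeps [3/2 - c] above both. *)
  rewrite /= !game_eu_pure1 !skewE.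
  by move: s => [[] []]; rewrite /game_u1 /=; lra.
apply: le_trans u2_ge; rewrite sim_eu_point_mass.
apply: Rintegral_prob_le; [exact: measurable_m_sim_u2|exact: m_sim_u2_bound|].
exact: game_m_sim_u2_le.
Qed.

(** This equilibrium pays player 2 exactly 5, so a Pareto improvement would have to pay more than
    5. *)
Lemma game_NE_exists : @NE R game (point_mass R (true, true)) (point_mass R None).
Proof.
split=> [sigma1|sigma2]; rewrite /eu !sum_point_mass.
  apply: le_weighted_sum => s.
  by rewrite /eu_pure1 !sum_point_mass.
rewrite /eu_pure1 [leRHS]sum_point_mass; apply: le_weighted_sum.
by case=> [[]|]; rewrite /= /game_u2 /=; lra.
Qed.

End Game.

Theorem theorem5p5 (R : realType) :
  exists G : nfg R,
    m_sim_introduces_pareto_improving_NE G /\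
    ~ p_sim_introduces_pareto_improving_NE G.
Proof.
exists (game R); split=> [|[c0 [c0_gt0 pareto]]].
  exists (1 / 2); split=> [|c c_gt0 c_lt]; first by lra.
  have [x [mu [ne u1E u2_ge]]] := game_m_sim_NE c_gt0 c_lt.
  exists x, mu; split=> // sigma1 sigma2 /game_NE_payoffs[u1_le u2_le].
  by rewrite u1E; split; lra.
(* One admissible cost suffices for the contradiction. *)
have [|x [mu [ne improves]]] := pareto (c0 / 2) _ ltac:(lra); first by lra.
have [_] := improves _ _ (game_NE_exists R).
have -> : eu (@u2 R (game R)) (point_mass R (true, true)) (point_mass R None) = 5.
  by rewrite /eu sum_point_mass /eu_pure1 sum_point_mass.
by rewrite ltNge (@game_p_sim_NE_u2 _ (c0 / 2)) //; lra.
Qed.
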